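(* Assume that the equation $-\nabla(f_n\Delta y_n)+q_ny_n=\lambda w_ny_n$, $1\le n\le N$, is in $\Omega_N^{\mathbb{R},+}$ (and fixed). Then each continuous eigenvalue branch over $\mathcal{B}_S$ is always strictly decreasing in the $\alpha$-direction and always strictly increasing in the $\beta$-direction.
   Context: $N\ge2$ is an integer, $\Delta y_n=y_{n+1}-y_n$, $\nabla y_n=y_n-y_{n-1}$. The equation is in $\Omega_N^{\mathbb{R},+}$ if $f_0,\dots,f_N$ are real and nonzero, $q_1,\dots,q_N$ are real, and $w_1,\dots,w_N>0$. $\mathcal{B}_S$ is the space of separated self-adjoint boundary conditions, each of which can be written as $$\mathbf{S}_{\alpha,\beta}:\quad \cos\alpha\, y_0-\sin\alpha\, (f_0\Delta y_0)=0,\qquad \cos\beta\, y_N-\sin\beta\,(f_N\Delta y_N)=0,$$ with $\alpha\in[0,\pi)$, $\beta\in(0,\pi]$; it has the topology induced from the quotient space of rank-$2$ complex $2\times4$ coefficient matrices modulo left multiplication by $GL(2,\mathbb{C})$. A number $\lambda$ is an eigenvalue for a boundary condition if there is a nonzero complex sequence $y=\{y_n\}_{n=0}^{N+1}$ satisfying both the equation and the boundary condition. For equations in $\Omega_N^{\mathbb{R},+}$ and boundary conditions in $\mathcal{B}_S$ all eigenvalues are real and simple. A continuous eigenvalue branch over $\mathcal{B}_S$ is a continuous function $\Lambda$ from a connected open subset of $\mathcal{B}_S$ to $\mathbb{R}$ such that $\Lambda(\mathbf{S})$ is an eigenvalue for $\mathbf{S}$ for each $\mathbf{S}$ in its domain.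 Monotonicity in the $\alpha$-direction (resp. $\beta$-direction) refers to the function $\alpha\mapsto\Lambda(\mathbf{S}_{\alpha,\beta})$ with $\beta$ fixed (resp. $\beta\mapsto\Lambda(\mathbf{S}_{\alpha,\beta})$ with $\alpha$ fixed) on intervals of the parameter for which $\mathbf{S}_{\alpha,\beta}$ lies in the domain of $\Lambda$. *)

(* Defs.v *)
From HB Require Import structures.
From mathcomp Require Import all_boot all_order all_algebra.
From mathcomp Require Import complex.
From mathcomp Require Import all_classical all_reals all_analysis.

Set Implicit Arguments.
Unset Strict Implicit.
Unset Printing Implicit Defensive.

Import Order.TTheory GRing.Theory Num.Theory.
Import numFieldNormedType.Exports.

Local Open Scope classical_set_scope.
Local Open Scope complex_scope.
Local Open Scope ring_scope.
Local Open Scope quotient_scope.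

(* MathComp-Analysis puts the norm topology on K^o for every numFieldType K;
   this transports it to R[i] itself, so that matrices over R[i] get the
   entrywise topology. *)
HB.instance Definition _ (R : realType) :=
  PseudoPointedMetric.copy R[i] (R[i]^o).

Section Difference.
Variable V : zmodType.
Implicit Types (y : nat -> V) (n : nat).

Definition fdiff y n : V := y n.+1 - y n.
Definition bdiff y n : V := y n - y n.-1.

End Difference.

Section BoundaryConditions.
Variable R : realType.
Local Notation C := R[i].

Definition bc_mx : set 'M[C]_(2, 4) := [set A | \rank A = 2%N].

Definition bc_equiv (A B : bc_mx) : bool :=
  `[< exists2 T : 'M[C]_2, T \in unitmx & val A = T *m val B >].

Lemma bc_equiv_refl : reflexive bc_equiv.
Proof.
by move=> A; apply/asboolP; exists 1%:M; rewrite ?unitmx1 ?mul1mx.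
Qed.

Lemma bc_equiv_sym : symmetric bc_equiv.
Proof.
suff sub A B : bc_equiv A B -> bc_equiv B A by move=> A B; apply/idP/idP => /sub.
move=> /asboolP[T uT AE]; apply/asboolP; exists (invmx T); rewrite ?unitmx_inv//.
by rewrite AE mulKmx.
Qed.

Lemma bc_equiv_trans : transitive bc_equiv.
Proof.
move=> B A D /asboolP[T uT AE] /asboolP[T' uT' BE]; apply/asboolP.
by exists (T *m T'); rewrite ?unitmx_mul ?uT// AE BE mulmxA.
Qed.

Canonical bc_equiv_rel :=
  EquivRel bc_equiv bc_equiv_refl bc_equiv_sym bc_equiv_trans.

Definition bc : Type := quotient_topology {eq_quot bc_equiv_rel}.

HB.instance Definition _ := Topological.on bc.
HB.instance Definition _ := Quotient.on bc.

Lemma bc_eqP (A B : bc_mx) :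
  reflect (exists2 T : 'M[C]_2, T \in unitmx & val A = T *m val B)
          (\pi_bc A == \pi_bc B).
Proof.
have -> : (\pi_bc A == \pi_bc B) = bc_equiv A B.
  by rewrite -[RHS](@eqmodE _ bc_equiv_rel); apply/eqP/eqP.
exact: asboolP.
Qed.

Section Sequences.
Variables (N : nat) (f : nat -> R).
Implicit Types y : nat -> C.

Definition quasi_diff y n : C := (f n)%:C * fdiff y n.

Definition bc_trace y : 'cV[C]_4 :=
  \col_j [:: y 0; quasi_diff y 0; y N; quasi_diff y N]`_j.

(* Independent of the representative, see [satisfies_bc_pi]. *)
Definition satisfies_bc (S : bc) y : Prop := val (repr S) *m bc_trace y = 0.

Lemma satisfies_bc_pi (A : bc_mx) y :
  satisfies_bc (\pi_bc A) y <-> val A *m bc_trace y = 0.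
Proof.
rewrite /satisfies_bc; have /eqP/bc_eqP[T uT ->] := reprK (\pi_bc A).
rewrite -mulmxA; split=> [/(congr1 (mulmx (invmx T)))|->].
  by rewrite mulKmx// mulmx0.
by rewrite mulmx0.
Qed.

(* Only y 0, ..., y N.+1 are meaningful. *)
Definition is_eigenvalue (q w : nat -> R) (S : bc) (lambda : C) : Prop :=
  exists y : nat -> C,
    [/\ exists2 n, (n <= N.+1)%N & y n != 0,
        forall n, (1 <= n <= N)%N ->
          - bdiff (quasi_diff y) n + (q n)%:C * y n = lambda * (w n)%:C * y n
      & satisfies_bc S y].

End Sequences.

Definition Omega_Rplus (N : nat) (f w : nat -> R) : Prop :=
  (forall n, (n <= N)%N -> f n != 0) /\ (forall n, (1 <= n <= N)%N -> 0 < w n).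

Definition sep_mx (alpha beta : R) : 'M[C]_(2, 4) :=
  \matrix_(i, j) (nth [::]
    [:: [:: (cos alpha)%:C; - (sin alpha)%:C; 0; 0];
        [:: 0; 0; (cos beta)%:C; - (sin beta)%:C]] i)`_j.

Lemma sep_mx_rank alpha beta : sep_mx alpha beta \in bc_mx.
Proof.
rewrite inE /=; apply/eqP; rewrite -[_ == _]/(row_free (sep_mx alpha beta)).
apply/row_freeP.
pose B : 'M[C]_(4, 2) := \matrix_(i, j)
  (nth [::] [:: [:: (cos alpha)%:C; 0]; [:: - (sin alpha)%:C; 0];
                [:: 0; (cos beta)%:C]; [:: 0; - (sin beta)%:C]] i)`_j.
have cs (t : R) : (cos t)%:C * (cos t)%:C + - (sin t)%:C * - (sin t)%:C = 1 :> C.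
  by rewrite mulrNN -!rmorphM -rmorphD -!expr2 cos2Dsin2 rmorph1.
exists B; apply/matrixP => i j; rewrite !mxE !big_ord_recl big_ord0 !mxE /=.
case: i => [[|[|//]] ?]; case: j => [[|[|//]] ?] /=;
  by rewrite ?(mul0r, mulr0, add0r, addr0) ?cs ?(mul0r, mulr0, add0r, addr0).
Qed.

Definition sep_bc (alpha beta : R) : bc :=
  \pi_bc (exist (fun A => A \in bc_mx) (sep_mx alpha beta)
                (sep_mx_rank alpha beta)).

Lemma satisfies_sep_bc N f alpha beta (y : nat -> C) :
  satisfies_bc N f (sep_bc alpha beta) y <->
    (cos alpha)%:C * y 0 - (sin alpha)%:C * quasi_diff f y 0 = 0 /\
    (cos beta)%:C * y N - (sin beta)%:C * quasi_diff f y N = 0.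
Proof.
rewrite satisfies_bc_pi /=; split=> [/matrixP sy|[y0 yN]].
  have := sy 1 0; have := sy 0 0.
  rewrite !mxE !big_ord_recl !big_ord0 !mxE /=.
  by rewrite !mul0r !(add0r, addr0) !mulNr.
apply/matrixP => i j; rewrite !mxE !big_ord_recl !big_ord0 !mxE /=.
by case: i => [[|[|//]] ?] /=; rewrite !mul0r !(add0r, addr0) !mulNr.
Qed.

Definition sep_bcs : set bc :=
  [set S | exists alpha beta : R,
     [/\ 0 <= alpha < pi, 0 < beta <= pi & S = sep_bc alpha beta]].

Definition continuous_eigenvalue_branch (N : nat) (f q w : nat -> R)
    (U : set bc) (Lambda : bc -> R) : Prop :=
  [/\ U `<=` sep_bcs /\ open (U : set (subspace sep_bcs)),
      connected U,
      {within U, continuous Lambda}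
    & forall S, U S -> is_eigenvalue N f q w S (Lambda S)%:C].

End BoundaryConditions.

(* Main.v *)
Require Import Defs.
From HB Require Import structures.
From mathcomp Require Import all_boot all_order all_algebra.
From mathcomp Require Import complex.
From mathcomp Require Import all_classical all_reals all_analysis.
From mathcomp Require Import ring lra.

Set Implicit Arguments.
Unset Strict Implicit.
Unset Printing Implicit Defensive.

Import Order.TTheory GRing.Theory Num.Theory.
Import numFieldNormedType.Exports.

Local Open Scope classical_set_scope.
Local Open Scope ring_scope.

(** The solutions of the equation satisfy a discrete Lagrange identity. For the
    real solution with initial data (y_0, f_0 Delta y_0) = (sin a, cos a), a
    separated condition at the right end says that (y_N, f_N Delta y_N) is a
    multiple c of (sin b, cos b). If y and z are two such eigensolutions, with
    angles (a1, b1), (a2, b2), amplitudes c1, c2 and eigenvalues l1, l2, then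
    telescoping their Casoratian between the two ends gives ([lagrange])
      c1 c2 sin(b2 - b1) - sin(a2 - a1) = (l2 - l1) sum_(1 <= n <= N) w_n y_n z_n.

    When the second boundary condition tends to the first along a continuous
    branch, l2 tends to l1; as solutions depend continuously on initial data
    and eigenvalue, c1 c2 tends to c1^2 and the sum tends to that of the
    w_n y_n^2. Both limits are positive, because a nonzero solution has neither
    y_N = f_N Delta y_N = 0 ([end_ampl_neq0]) nor y_1 = ... = y_N = 0
    ([wdot_gt0]). So near each point l2 - l1 has the sign of sin(b2 - b1) if
    only b moves, and that of - sin(a2 - a1) if only a moves ([branch_near]).
    This is strict monotonicity near each point; a supremum argument
    ([homo_lt_local]) makes it global on an interval.

    The continuity of a branch is stated on a quotient of a space of complex
    matrices; it becomes continuity in the angles through [cvg_sep_bc]. *)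

(** * From local to global strict monotonicity *)

(** For x < y in the interval, the supremum of the points t of [x, y] with t = x
    or g x < g t is attained by the left half of the local hypothesis, and the
    right half forbids it to be less than y. *)
Lemma homo_lt_local (R : realType) (I : interval R) (g : R -> R) :
  {in I, forall a, \forall t \near within [set` I] (nbhs a),
    (a < t -> g a < g t) /\ (t < a -> g t < g a)} ->
  {in I &, {homo g : x y / x < y}}.
Proof.
move=> gloc x y xI yI xy.
have itvI t : x <= t <= y -> t \in I.
  by move=> ?; exact: (interval_is_interval xI yI).
have loc a : a \in I -> exists2 e : R, 0 < e & forall t, t \in I ->
    `|a - t| < e -> (a < t -> g a < g t) /\ (t < a -> g t < g a).
  move=> /gloc; rewrite near_withinE => -[e /= e0 He].
  by exists e => // t tI at_e; apply: He.
pose A := [set t | x <= t <= y /\ (t = x \/ g x < g t)].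
have Ax : A x by split; [rewrite lexx ltW|left].
have supA : has_sup A.
  by split; [exists x|exists y => t [/andP[]]].
set s := sup A.
have xs : x <= s by apply: ub_le_sup => //; case: supA.
have sy : s <= y by apply: ge_sup; [exists x|move=> t [/andP[]]].
have sI : s \in I by apply: itvI; rewrite xs.
have [e e0 He] := loc s sI.
have As : A s.
  have [t At st] := sup_adherent e0 supA.
  have ts : t <= s by apply: ub_le_sup => //; case: supA.
  split; first by rewrite xs.
  have [<-|ts'] := eqVneq t s; first by case: At.
  have {}ts' : t < s by rewrite lt_neqAle ts'.
  case: At => xty gt; right.
  have [_ /(_ ts') gts] : (s < t -> g s < g t) /\ (t < s -> g t < g s).
    by apply: He; [exact: itvI|rewrite gtr0_norm ?subr_gt0// -/s in st *; lra].
  by case: gt => [<-//|gt]; exact: lt_trans gts.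
(* If s < y, then A contains a point slightly to the right of s. *)
have gxs : s = x \/ g x < g s by case: As.
have [sEy|sNy] := eqVneq s y.
  by case: gxs; rewrite sEy// => yx; rewrite yx ltxx in xy.
have {sNy} sy' : s < y by rewrite lt_neqAle sNy.
pose t := Num.min y (s + e / 2).
have st : s < t by rewrite lt_min sy' ltrDl divr_gt0.
have ty : t <= y by rewrite ge_min lexx.
have tse : t <= s + e / 2 by rewrite ge_min lexx orbT.
have xty : x <= t <= y by rewrite ty (le_trans xs (ltW st)).
have [/(_ st) gst _] : (s < t -> g s < g t) /\ (t < s -> g t < g s).
  by apply: He; [exact: itvI|rewrite distrC gtr0_norm ?subr_gt0//; lra].
suff : t <= s by rewrite leNgt st.
apply: ub_le_sup; first by case: supA.
split=> //; right; case: gxs => [<-//|gxs]; exact: lt_trans gst.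
Qed.

(** The form in which the Lagrange identity controls a branch: on an interval
    shorter than pi, sin (t - a) has the sign of t - a. *)
Lemma homo_lt_sin (R : realType) (I : interval R) (g : R -> R) :
  {in I &, forall x y, `|x - y| < pi} ->
  {in I, forall a, \forall t \near within [set` I] (nbhs a),
    exists c s : R, [/\ 0 < c, 0 < s & c * sin (t - a) = (g t - g a) * s]} ->
  {in I &, {homo g : x y / x < y}}.
Proof.
move=> Ipi gloc; apply: homo_lt_local => a aI.
have := gloc a aI; rewrite !near_withinE; apply: filterS => t + tI.
move=> /(_ tI)[c [s [c0 s0 E]]].
have := Ipi t a tI aI; rewrite ltr_norml => /andP[tapi atpi].
split=> ta.
- rewrite -subr_gt0 -(pmulr_lgt0 _ s0) -E pmulr_rgt0// sin_gt0_pi//.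
  by rewrite atpi subr_gt0 ta.
- rewrite -subr_lt0 -(pmulr_llt0 _ s0) -E pmulr_rlt0// -oppr_gt0 -sinN.
  by rewrite sin_gt0_pi// oppr_gt0 subr_lt0 ta/= ltrNl.
Qed.

(** * Real solutions and the Lagrange identity *)

Section Solution.
Variables (R : realType) (N : nat) (f q w : nat -> R).

(** The pair (y_n, f_n Delta y_n). In these two coordinates the equation is a
    first-order recursion, and both boundary conditions are linear conditions
    on one state. *)
Fixpoint sol (a l : R) (n : nat) : R * R :=
  if n is m.+1 then
    let u := sol a l m in
    let y := u.1 + u.2 / f m in (y, u.2 + (q m.+1 - l * w m.+1) * y)
  else (sin a, cos a).

(** Vanishes exactly when the solution satisfies the right boundary condition. *)
Definition char_fun a b l : R :=
  cos b * (sol a l N).1 - sin b * (sol a l N).2.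

(** The component of the state at N along the unit vector (sin b, cos b), which
    spans the right boundary condition. *)
Definition end_ampl a b l : R :=
  sin b * (sol a l N).1 + cos b * (sol a l N).2.

Definition wdot (a1 l1 a2 l2 : R) : R :=
  \sum_(1 <= n < N.+1) w n * ((sol a1 l1 n).1 * (sol a2 l2 n).1).

Lemma char_fun_end a b l : char_fun a b l = 0 ->
  (sol a l N).1 = end_ampl a b l * sin b /\
  (sol a l N).2 = end_ampl a b l * cos b.
Proof.
rewrite /char_fun /end_ampl; case: (sol a l N) => y p /= D0.
have cs := cos2Dsin2 b.
split; apply/eqP; rewrite -subr_eq0; apply/eqP.
  transitivity (y * (1 - (cos b ^+ 2 + sin b ^+ 2))
                + cos b * (cos b * y - sin b * p)); first by ring.
  by rewrite cs D0 subrr !mulr0 addr0.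
transitivity (p * (1 - (cos b ^+ 2 + sin b ^+ 2))
              - sin b * (cos b * y - sin b * p)); first by ring.
by rewrite cs D0 subrr !mulr0 subr0.
Qed.

(** The Casoratian W_n = f_n (Delta y_n z_n - y_n Delta z_n) has increments
    (l2 - l1) w_n y_n z_n, since f and q contribute the same to both solutions.
    At an end where the states are multiples of (sin, cos) of angles u and v,
    it is the product of the amplitudes times sin (v - u). *)
Lemma lagrange a1 b1 l1 a2 b2 l2 :
  char_fun a1 b1 l1 = 0 -> char_fun a2 b2 l2 = 0 ->
  end_ampl a1 b1 l1 * end_ampl a2 b2 l2 * sin (b2 - b1) - sin (a2 - a1) =
  (l2 - l1) * wdot a1 l1 a2 l2.
Proof.
move=> /char_fun_end[y1 p1] /char_fun_end[y2 p2].
pose W n := (sol a1 l1 n).2 * (sol a2 l2 n).1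
            - (sol a1 l1 n).1 * (sol a2 l2 n).2.
have -> : sin (a2 - a1) = W 0%N by rewrite /W /= sinB; ring.
transitivity (W N - W 0%N).
  by rewrite /W y1 y2 p1 p2 sinB; ring.
rewrite -telescope_sumr// /wdot big_add1 mulr_sumr.
by apply: eq_bigr => n _; rewrite /W /=; ring.
Qed.

Hypothesis fN0 : forall n, (n <= N)%N -> f n != 0.

(** The recursion is invertible: a state (0, 0) at any step would propagate back
    to the initial state (sin a, cos a). *)
Lemma sol_neq0 a l n : (n <= N)%N -> sol a l n != (0, 0).
Proof.
elim: n => [_|n IHn nN] /=.
  rewrite xpair_eqE; apply/negP => /andP[/eqP s0 /eqP c0].
  have := cos2Dsin2 a; rewrite s0 c0 expr0n addr0 => /eqP.
  by rewrite eq_sym oner_eq0.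
have := IHn (ltnW nN); case: (sol a l n) => y p /=.
apply: contra; rewrite !xpair_eqE => /andP[/eqP y0].
rewrite y0 mulr0 addr0 => /eqP p0.
by move: y0; rewrite p0 mul0r addr0 => ->; rewrite eqxx.
Qed.

Lemma end_ampl_neq0 a b l : char_fun a b l = 0 -> end_ampl a b l != 0.
Proof.
move=> /char_fun_end[yN pN]; have := sol_neq0 a l (leqnn N).
apply: contra => /eqP c0; move: yN pN; rewrite c0 !mul0r.
by case: (sol a l N) => y p /= -> ->.
Qed.

Hypothesis w0 : forall n, (1 <= n <= N)%N -> 0 < w n.
Hypothesis N2 : (2 <= N)%N.

(** A zero sum would force y_1 = y_2 = 0, hence f_1 Delta y_1 = 0, so the whole
    state at 1 would vanish. This is where N >= 2 is used. *)
Lemma wdot_gt0 a l : 0 < wdot a l a l.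
Proof.
have term_ge0 n : (1 <= n < N.+1)%N ->
    0 <= w n * ((sol a l n).1 * (sol a l n).1).
  by move=> nN; apply: mulr_ge0; [exact/ltW/w0|rewrite -expr2 sqr_ge0].
rewrite /wdot lt_neqAle; apply/andP; split; last first.
  by rewrite big_nat; apply: sumr_ge0 => n /term_ge0.
rewrite eq_sym big_nat psumr_eq0; last by move=> n /term_ge0.
apply/negP => /allP sum0.
have y0 n : (1 <= n <= N)%N -> (sol a l n).1 = 0.
  move=> nN; have := sum0 n; rewrite mem_index_iota => /(_ nN)/implyP/(_ nN).
  by rewrite mulf_eq0 gt_eqF ?w0//= -expr2 sqrf_eq0 => /eqP.
have /negP := sol_neq0 a l (ltnW N2); apply.
have := y0 2; have := y0 1%N; rewrite (ltnW N2) N2.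
move=> /(_ erefl) y1 /(_ erefl).
rewrite (_ : (sol a l 2).1 = (sol a l 1).1 + (sol a l 1).2 / f 1)// y1 add0r.
move=> /eqP; rewrite mulf_eq0 invr_eq0 (negbTE (fN0 (ltnW N2))) orbF => p1.
by rewrite [sol a l 1]surjective_pairing xpair_eqE y1 eqxx.
Qed.

(** * Perturbation of an eigensolution *)

Section Cvg.
Variables (T : Type) (F : set_system T) (FF : Filter F).
Variables (al be la : T -> R) (a b l : R).
Hypotheses (cal : al t @[t --> F] --> a) (cbe : be t @[t --> F] --> b)
  (cla : la t @[t --> F] --> l).

Lemma cvg_sol n :
  ((sol (al t) (la t) n).1 @[t --> F] --> (sol a l n).1) /\
  ((sol (al t) (la t) n).2 @[t --> F] --> (sol a l n).2).
Proof.
elim: n => [|n [IHy IHp]] /=.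
  split; first by apply: (cvg_comp _ _ cal); exact: continuous_sin.
  by apply: (cvg_comp _ _ cal); exact: continuous_cos.
have cy : (sol (al t) (la t) n).1 + (sol (al t) (la t) n).2 / f n @[t --> F]
    --> (sol a l n).1 + (sol a l n).2 / f n.
  by apply: cvgD => //; apply: cvgM => //; exact: cvg_cst.
split=> //; apply: cvgD => //; apply: cvgM => //; apply: cvgB.
  exact: cvg_cst.
by apply: cvgM => //; exact: cvg_cst.
Qed.

(** The amplitudes have a definite sign only relative to each other: their
    product is positive near the limit, where it is a nonzero square. *)
Lemma near_lagrange : char_fun a b l = 0 ->
  (\forall t \near F, char_fun (al t) (be t) (la t) = 0) ->
  \forall t \near F, exists c s : R, [/\ 0 < c, 0 < s &
    c * sin (be t - b) - sin (al t - a) = (la t - l) * s].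
Proof.
move=> D0 nearD0.
have cE : end_ampl a b l * end_ampl (al t) (be t) (la t) @[t --> F] -->
    end_ampl a b l * end_ampl a b l.
  have [cy cp] := cvg_sol N.
  apply: cvgM; first exact: cvg_cst.
  apply: cvgD; apply: cvgM => //.
    by apply: (cvg_comp _ _ cbe); exact: continuous_sin.
  by apply: (cvg_comp _ _ cbe); exact: continuous_cos.
have cW : wdot a l (al t) (la t) @[t --> F] --> wdot a l a l.
  apply: cvg_big => [|n _]; first exact: add_continuous.
  apply: cvgM; first exact: cvg_cst.
  by apply: cvgM; [exact: cvg_cst|case: (cvg_sol n)].
have E0 : 0 < end_ampl a b l * end_ampl a b l.
  by rewrite -expr2 exprn_even_gt0//= end_ampl_neq0.
near=> t; exists (end_ampl a b l * end_ampl (al t) (be t) (la t)).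
exists (wdot a l (al t) (la t)); split.
- by near: t; exact: (cvgr_gt _ cE).
- by near: t; exact: (cvgr_gt _ cW _ (wdot_gt0 a l)).
- by apply: lagrange => //; near: t.
Unshelve. all: by end_near. Qed.

End Cvg.
End Solution.

(** * From complex boundary conditions to angles *)

Section Complex.
Local Open Scope complex_scope.

(** The left condition makes the initial state of a complex eigensolution a
    complex multiple k of (sin a, cos a); the eigensolution is then k times the
    real solution [sol], with k nonzero, so that the right condition passes to
    [sol]. *)
Lemma is_eigenvalue_char_fun (R : realType) N (f q w : nat -> R) a b l :
  (forall n, (n <= N)%N -> f n != 0) ->
  is_eigenvalue N f q w (sep_bc a b) l%:C -> char_fun N f q w a b l = 0.
Proof.
move=> fN0 [y [[n0 n0N yn0] eqy /satisfies_sep_bc[bca bcb]]].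
pose k := (sin a)%:C * y 0 + (cos a)%:C * quasi_diff f y 0.
have cs : (cos a)%:C ^+ 2 + (sin a)%:C ^+ 2 = 1 :> R[i].
  by rewrite -!rmorphXn -rmorphD/= cos2Dsin2.
have ystep n : (n <= N)%N -> y n.+1 = y n + quasi_diff f y n * ((f n)^-1)%:C.
  move=> nN; rewrite /quasi_diff /fdiff mulrAC -rmorphM/= mulfV ?fN0//.
  by rewrite rmorph1; ring.
have yE n : (n <= N)%N -> y n = k * (sol f q w a l n).1%:C /\
    quasi_diff f y n = k * (sol f q w a l n).2%:C.
  elim: n => [_|n IHn nN].
    rewrite /= /k; move: (quasi_diff f y 0) (y 0%N) bca => p y0 bca.
    split; apply/eqP; rewrite -subr_eq0; apply/eqP.
      transitivity (y0 * (1 - ((cos a)%:C ^+ 2 + (sin a)%:C ^+ 2))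
        + (cos a)%:C * ((cos a)%:C * y0 - (sin a)%:C * p)); first by ring.
      by rewrite cs bca subrr !mulr0 addr0.
    transitivity (p * (1 - ((cos a)%:C ^+ 2 + (sin a)%:C ^+ 2))
      - (sin a)%:C * ((cos a)%:C * y0 - (sin a)%:C * p)); first by ring.
    by rewrite cs bca subrr !mulr0 subr0.
  have [yn pn] := IHn (ltnW nN).
  have yn1 : y n.+1 = k * (sol f q w a l n.+1).1%:C.
    by rewrite ystep ?(ltnW nN)// yn pn/= rmorphD rmorphM/=; ring.
  split=> //.
  have := eqy n.+1 nN; rewrite /bdiff pn /= => e.
  have -> : quasi_diff f y n.+1 =
      k * (sol f q w a l n).2%:C + ((q n.+1)%:C - l%:C * (w n.+1)%:C) * y n.+1.
    move/eqP: e; rewrite -subr_eq0 -oppr_eq0 => /eqP e.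
    by apply/eqP; rewrite -subr_eq0 -[X in _ == X]e; apply/eqP; ring.
  by rewrite yn1 !(rmorphD, rmorphM, rmorphB)/=; ring.
have k0 : k != 0.
  apply: contraNneq yn0 => k0; move: n0N; rewrite leq_eqVlt ltnS.
  (* [yE] covers the indices up to N; y_(N+1) is one more step away. *)
  case/predU1P => [->|/yE[-> _]]; last by rewrite k0 mul0r.
  by have [yN pN] := yE N (leqnn N); rewrite ystep// yN pN k0 !mul0r addr0.
have [yN pN] := yE N (leqnn N); move: bcb; rewrite yN pN.
have -> : (cos b)%:C * (k * (sol f q w a l N).1%:C)
    - (sin b)%:C * (k * (sol f q w a l N).2%:C)
    = k * (char_fun N f q w a b l)%:C :> R[i].
  by rewrite /char_fun !(rmorphB, rmorphM)/=; ring.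
move=> /eqP; rewrite mulf_eq0 (negbTE k0)/= => /eqP/(congr1 (@complex.Re R)).
by [].
Qed.

Lemma cvg_real_complex (R : realType) (T : Type) (F : set_system T) (FF : Filter F)
    (g : T -> R) (x : R) :
  g t @[t --> F] --> x -> (g t)%:C @[t --> F] --> (x%:C : R[i]).
Proof.
move=> /cvgrPdist_lt cg; apply/cvg_ballP => -[e e'].
rewrite ltcE/= => /andP[/eqP -> e0].
have := cg _ e0; apply: filterS => t.
rewrite /ball/= /ball_/= -rmorphB normc_def/= expr0n addr0 sqrtr_sqr.
by rewrite ltcR.
Qed.

(** Convergence holds entrywise for the matrices, hence in the subspace of
    rank-2 matrices and, the projection being continuous, in the quotient. *)
Lemma cvg_sep_bc (R : realType) (T : Type) (F : set_system T) (FF : Filter F)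
    (al be : T -> R) (a b : R) :
  al t @[t --> F] --> a -> be t @[t --> F] --> b ->
  sep_bc (al t) (be t) @[t --> F] --> sep_bc a b.
Proof.
move=> cal cbe.
have ccos (g : T -> R) c : g t @[t --> F] --> c ->
   (cos (g t))%:C @[t --> F] --> ((cos c)%:C : R[i]).
  move=> cg; apply: cvg_real_complex.
  by apply: (cvg_comp _ _ cg); exact: continuous_cos.
have csin (g : T -> R) c : g t @[t --> F] --> c ->
   - (sin (g t))%:C @[t --> F] --> (- (sin c)%:C : R[i]).
  move=> cg; rewrite -rmorphN; under eq_fun do rewrite -rmorphN.
  apply: cvg_real_complex; apply: cvgN.
  by apply: (cvg_comp _ _ cg); exact: continuous_sin.
pose A a b : @bc_mx R :=
  exist (fun A => A \in @bc_mx R) (sep_mx a b) (sep_mx_rank a b).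
have cmx : sep_mx (al t) (be t) @[t --> F] --> sep_mx a b.
  apply/(@cvg_ballP R[i] 'M[R[i]]_(2, 4)) => e e0.
  have entries i j : \forall t \near F,
      ball (sep_mx a b i j) e (sep_mx (al t) (be t) i j).
    apply: (cvg_ball _ e0); rewrite /sep_mx !mxE; under eq_fun do rewrite mxE.
    by case: i => [[|[|//]] ?]; case: j => [[|[|[|[|//]]]] ?] /=;
      solve [exact: cvg_cst|exact: ccos|exact: csin].
  have {}entries i := filter_forall FF (entries i).
  by apply: (filterS _ (filter_forall FF entries)) => t entries_t; split.
have cA : A (al t) (be t) @[t --> F] --> A a b.
  move=> V [_ [[B oB <-] BA] BV]; apply: (filterS BV).
  by apply: cmx; exact: open_nbhs_nbhs.
apply: (cvg_comp _ _ cA); exact: pi_continuous.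
Qed.

End Complex.

(** * Monotonicity of eigenvalue branches *)

(** Both boundary angles may vary with one real parameter, which covers the two
    directions at once. *)
Lemma branch_near (R : realType) N (f q w : nat -> R) (U : set (bc R))
    (Lambda : bc R -> R) (I : interval R) (al be : R -> R) (a : R) :
  (2 <= N)%N -> Omega_Rplus N f w ->
  continuous_eigenvalue_branch N f q w U Lambda ->
  continuous al -> continuous be ->
  {in I, forall t, U (sep_bc (al t) (be t))} -> a \in I ->
  \forall t \near within [set` I] (nbhs a), exists c s : R, [/\ 0 < c, 0 < s &
    c * sin (be t - be a) - sin (al t - al a) =
    (Lambda (sep_bc (al t) (be t)) - Lambda (sep_bc (al a) (be a))) * s].
Proof.
move=> N2 [fN0 w0] [_ _ cL eigL] cal cbe IU aI.
pose L t := Lambda (sep_bc (al t) (be t)).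
have char0 t : t \in I -> char_fun N f q w (al t) (be t) (L t) = 0.
  by move=> /IU/eigL/(is_eigenvalue_char_fun fN0).
apply: (near_lagrange fN0 w0 N2).
- by apply: cvg_within_filter; exact: cal.
- by apply: cvg_within_filter; exact: cbe.
- have cS : sep_bc (al t) (be t) @[t --> within [set` I] (nbhs a)] -->
      within U (nbhs (sep_bc (al a) (be a))).
    have cS : sep_bc (al t) (be t) @[t --> nbhs a] --> sep_bc (al a) (be a).
      by apply: cvg_sep_bc; [exact: cal|exact: cbe].
    move=> V /cS; rewrite /= !nbhs_simpl /within /= => VS.
    by apply: filterS VS => t VSt tI; apply: VSt; exact: IU.
  apply: (cvg_comp _ _ cS).
  by move/subspace_continuousP : cL; apply; exact: IU.
- exact: char0.
- by rewrite near_withinE; apply: nearW => t /char0.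
Qed.

Theorem theorem4p4 (R : realType) (N : nat) (f q w : nat -> R)
    (U : set (bc R)) (Lambda : bc R -> R) :
  (2 <= N)%N ->
  Omega_Rplus N f w ->
  continuous_eigenvalue_branch N f q w U Lambda ->
  (forall (beta : R) (I : interval R),
     0 < beta <= pi ->
     {in I, forall alpha : R, 0 <= alpha < pi /\ U (sep_bc alpha beta)} ->
     {in I &, {homo (fun alpha => Lambda (sep_bc alpha beta)) :
               x y /~ x < y}}) /\
  (forall (alpha : R) (I : interval R),
     0 <= alpha < pi ->
     {in I, forall beta : R, 0 < beta <= pi /\ U (sep_bc alpha beta)} ->
     {in I &, {homo (fun beta => Lambda (sep_bc alpha beta)) :
               x y / x < y}}).
Proof.
move=> N2 Om br; split=> [beta I _ IU|alpha I _ IU].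
(* Monotonicity in alpha is reduced to the increasing case by a sign change:
   here the term in sin (b2 - b1) vanishes, and sin (a2 - a1) enters with a minus. *)
- suff incr : {in I &, {homo (fun a => - Lambda (sep_bc a beta)) :
      x y / x < y}}.
    by move=> x y xI yI yx; rewrite -ltrN2; exact: incr.
  apply: homo_lt_sin => [x y /IU[x0 _] /IU[y0 _]|a aI].
    by rewrite ltr_norml; lra.
  have cid : continuous (@id R) by move=> ?; exact: cvg_id.
  have cb : continuous (fun _ : R => beta) by move=> ?; exact: cvg_cst.
  have := branch_near N2 Om br cid cb (fun t tI => (IU t tI).2) aI.
  apply: filterS => t [c [s [_ s0]]].
  rewrite subrr sin0 mulr0 sub0r => E; exists 1, s; split=> //.
  by rewrite mul1r -opprD mulNr -E opprK.
- apply: homo_lt_sin => [x y /IU[x0 _] /IU[y0 _]|b bI].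
    by rewrite ltr_norml; lra.
  have cid : continuous (@id R) by move=> ?; exact: cvg_id.
  have ca : continuous (fun _ : R => alpha) by move=> ?; exact: cvg_cst.
  have := branch_near N2 Om br ca cid (fun t tI => (IU t tI).2) bI.
  apply: filterS => t [c [s [c0 s0]]].
  by rewrite subrr sin0 subr0 => E; exists c, s.
Qed.
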